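(* Let $L$ be a frame. Then $L\textbf{-Sob}$, the full subcategory of sober $L$-topological spaces, is the epireflective hull of the Sierpinski $L$-topological space $L_{S}$ in the category $L\textbf{-Top}_{0}$ of $T_0$-$L$-topological spaces.
   Context: A frame is a complete lattice $L$ satisfying $a\wedge\bigvee_i b_i=\bigvee_i(a\wedge b_i)$; its least and largest elements are $0,1$. A frame map is a map between frames preserving finite infima and arbitrary suprema. For a set $X$, $L^X$ carries the pointwise order. An $L$-topology on $X$ is a subset $\tau\subseteq L^X$ closed under arbitrary suprema and finite infima (in particular containing the constant maps $\bar 0$ and $\bar 1$), so $\tau$ is itself a frame; $(X,\tau)$ is then an $L$-topological space. A map $f:(X,\tau)\to(Y,\delta)$ is continuous if $f^{\leftarrow}(\nu):=\nu\circ f\in\tau$ for every $\nu\in\delta$. $L\textbf{-Top}$ is the category of $L$-topological spaces and continuous maps. For $\zeta\subseteq L^X$, $\langle\zeta\rangle$ is the $L$-topology consisting of all suprema of finite infima of members of $\zeta$. The Sierpinski $L$-topological space is $L_S=(L,\langle\{\mathrm{id}_L\}\rangle)$. $(X,\tau)$ is $T_0$ if for all distinct $x,y\in X$ there is $\mu\in\tau$ with $\mu(x)\ne\mu(y)$; $L\textbf{-Top}_0$ is the full subcategory of $L\textbf{-Top}$ of $T_0$ spaces. For a frame $A$, $pt_LA$ denotes the set of frame maps $A\to L$. $(X,\tau)$ is sober if for every $p\in pt_L\tau$ there is a unique $x\in X$ such that $p(\mu)=\mu(x)$ for every $\mu\in\tau$. $L\textbf{-Sob}$ is the full subcategory of sober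 spaces; every sober space is $T_0$. All subcategories are full and replete. A subcategory $\mathscr R$ of $\mathscr C$ is epireflective in $\mathscr C$ if for each $\mathscr C$-object $X$ there is a $\mathscr C$-epimorphism $r_X:X\to RX$ with $RX\in\mathscr R$ such that each $\mathscr C$-morphism $f:X\to Y$ with $Y\in\mathscr R$ factors as $f=f^*\circ r_X$ for a unique morphism $f^*:RX\to Y$. The epireflective hull of an object $E$ in $\mathscr C$ is the smallest epireflective subcategory of $\mathscr C$ containing $E$. *)

(* Defs.v *)
From HB Require Import structures.
From mathcomp Require Import all_boot all_order.
From mathcomp Require Import mathcomp_extra boolp classical_sets.

Set Implicit Arguments.
Unset Strict Implicit.
Unset Printing Implicit Defensive.

Import Order.TTheory.
Local Open Scope classical_set_scope.

HB.mixin Record TBLattice_isFrame (d : Order.disp_t) T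
    of Order.TBLattice d T := {
  bigsup : set T -> T;
  bigsup_ub : forall (A : set T) x, A x -> (x <= bigsup A)%O;
  bigsup_least : forall (A : set T) y,
    (forall x, A x -> (x <= y)%O) -> (bigsup A <= y)%O;
  meet_bigsup : forall a (B : set T),
    (a `&` bigsup B)%O = bigsup [set (a `&` b)%O | b in B]
}.

#[short(type="frameType")]
HB.structure Definition Frame d :=
  {T of TBLattice_isFrame d T & Order.TBLattice d T}.

Record frame_map d1 d2 (A : frameType d1) (B : frameType d2) (f : A -> B)
    : Prop := FrameMap {
  frame_map_top : f \top%O = \top%O;
  frame_map_meet : forall a b, f (a `&` b)%O = (f a `&` f b)%O;
  frame_map_bigsup : forall S : set A, f (bigsup S) = bigsup (f @` S)
}.

Definition pt d1 d2 (L : frameType d1) (A : frameType d2) : Type :=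
  {p : A -> L | frame_map p}.

(* The lattice structure on [X -> L] given by [boolp] is the pointwise one. *)
Section FunFrame.
Context (X : Type) (d : Order.disp_t) (L : frameType d).
Implicit Types (f g : X -> L) (A : set (X -> L)).

Let bot_le f : ((fun=> \bot%O) <= f)%O.
Proof. by apply/lefP => x; exact: le0x. Qed.

Let le_top f : (f <= (fun=> \top%O))%O.
Proof. by apply/lefP => x; exact: lex1. Qed.

HB.instance Definition _ :=
  Order.hasBottom.Build FunOrder.fun_display (X -> L) bot_le.
HB.instance Definition _ :=
  Order.hasTop.Build FunOrder.fun_display (X -> L) le_top.

Definition fun_bigsup A : X -> L := fun x => bigsup [set f x | f in A].

Let fun_bigsup_ub A f : A f -> (f <= fun_bigsup A)%O.
Proof. by move=> Af; apply/lefP => x; apply: bigsup_ub; exists f. Qed.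

Let fun_bigsup_least A g :
  (forall f, A f -> (f <= g)%O) -> (fun_bigsup A <= g)%O.
Proof.
move=> Ag; apply/lefP => x; apply: bigsup_least => _ [f Af <-].
by move/lefP: (Ag f Af); apply.
Qed.

Let meet_fun_bigsup f A :
  Order.meet f (fun_bigsup A) = fun_bigsup [set Order.meet f g | g in A].
Proof.
apply/funext => x; transitivity (Order.meet (f x) (fun_bigsup A x)) => //.
rewrite meet_bigsup; congr bigsup; apply/seteqP; split => [_ [_ [g Ag <-] <-]|].
  by exists (Order.meet f g) => //; exists g.
by move=> _ [_ [g Ag <-] <-]; exists (g x) => //; exists g.
Qed.

HB.instance Definition _ := TBLattice_isFrame.Build FunOrder.fun_display (X -> L)
  fun_bigsup_ub fun_bigsup_least meet_fun_bigsup.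

End FunFrame.

(* Closure under finite infima is closure under the empty and binary ones. *)
Record is_ltopology d (L : frameType d) (X : Type) (tau : set (X -> L))
    : Prop := IsLTopology {
  ltopology_bigsup : forall A : set (X -> L), A `<=` tau -> tau (bigsup A);
  ltopology_top : tau \top%O;
  ltopology_meet : forall mu nu, tau mu -> tau nu -> tau (mu `&` nu)%O
}.

Record ltop d (L : frameType d) := LTop {
  ltop_sort :> Type;
  ltop_open : set (ltop_sort -> L);
  ltop_axiom : is_ltopology ltop_open
}.
Arguments ltop_open {d L} X : rename.
Arguments ltop_axiom {d L} X : rename.

(* The frame structure of an L-topology, induced from [X -> L]. *)
Section OpenFrame.
Context (d : Order.disp_t) (L : frameType d) (X : ltop L).

Definition open_pred : {pred X -> L} := fun mu => mu \in ltop_open X.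

Record opens := Opens { open_val :> X -> L; open_valP : open_val \in open_pred }.

HB.instance Definition _ := [isSub for open_val].
HB.instance Definition _ := [Choice of opens by <:].

Lemma openE (mu : X -> L) : (mu \in open_pred) = `[< ltop_open X mu >].
Proof. by []. Qed.

Let open1 : (\top%O : X -> L) \in open_pred.
Proof. by rewrite openE; apply/asboolP; exact: ltopology_top (ltop_axiom X). Qed.

Let openI : {in open_pred &, forall mu nu, Order.meet mu nu \in open_pred}.
Proof.
move=> mu nu; rewrite !openE => /asboolP omu /asboolP onu.
by apply/asboolP; exact: ltopology_meet (ltop_axiom X) _ _ omu onu.
Qed.

Lemma open_bigsup (A : set (X -> L)) :
  A `<=` ltop_open X -> bigsup A \in open_pred.
Proof.
by move=> oA; rewrite openE; apply/asboolP; exact: ltopology_bigsup (ltop_axiom X) _ oA.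
Qed.

Let open0 : (\bot%O : X -> L) \in open_pred.
Proof.
suff -> : \bot%O = bigsup set0 :> (X -> L) by apply: open_bigsup.
by apply/eqP; rewrite eq_le le0x /=; apply: bigsup_least.
Qed.

Let openU : {in open_pred &, forall mu nu, Order.join mu nu \in open_pred}.
Proof.
move=> mu nu; rewrite !openE => /asboolP omu /asboolP onu.
have -> : Order.join mu nu = bigsup [set mu; nu].
  apply/eqP; rewrite eq_le leUx !bigsup_ub /=; [|by right|by left].
  by apply: bigsup_least => _ [->|->]; rewrite ?leUl ?leUr.
by rewrite -openE; apply: open_bigsup => _ [->|->].
Qed.

HB.instance Definition _ := Order.isTBLatticeClosed.Build
  FunOrder.fun_display (X -> L) open_pred openI openU open0 open1.
HB.instance Definition _ :=
  [SubChoice_isTBSubLattice of opens by <: with FunOrder.fun_display].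

Let open_image (A : set opens) : open_val @` A `<=` ltop_open X.
Proof. by move=> _ [mu _ <-]; have := open_valP mu; rewrite openE => /asboolP. Qed.

Definition opens_bigsup (A : set opens) : opens :=
  Opens (open_bigsup (@open_image A)).

Let opens_bigsup_ub A (mu : opens) : A mu -> (mu <= opens_bigsup A)%O.
Proof.
by move=> Amu; rewrite -Order.le_val; apply: bigsup_ub; exists mu.
Qed.

Let opens_bigsup_least A (nu : opens) :
  (forall mu, A mu -> (mu <= nu)%O) -> (opens_bigsup A <= nu)%O.
Proof.
move=> Anu; rewrite -Order.le_val; apply: bigsup_least => _ [mu Amu <-].
by have := Anu mu Amu; rewrite -Order.le_val.
Qed.

Let meet_opens_bigsup (mu : opens) (A : set opens) :
  Order.meet mu (opens_bigsup A) = opens_bigsup [set Order.meet mu nu | nu in A].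
Proof.
apply/val_inj; transitivity (Order.meet (open_val mu) (bigsup (open_val @` A))).
  by [].
rewrite meet_bigsup; congr bigsup; apply/seteqP; split.
  by move=> _ [_ [nu Anu <-] <-]; exists (Order.meet mu nu) => //; exists nu.
by move=> _ [_ [nu Anu <-] <-]; exists (open_val nu) => //; exists nu.
Qed.

HB.instance Definition _ := TBLattice_isFrame.Build FunOrder.fun_display opens
  opens_bigsup_ub opens_bigsup_least meet_opens_bigsup.

End OpenFrame.

Definition lcontinuous d (L : frameType d) (X Y : ltop L) (f : X -> Y) : Prop :=
  forall nu, ltop_open Y nu -> ltop_open X (nu \o f).

Definition T0 d (L : frameType d) (X : ltop L) : Prop :=
  forall x y : X, x <> y -> exists2 mu, ltop_open X mu & mu x <> mu y.

Definition sober d (L : frameType d) (X : ltop L) : Prop :=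
  forall p : pt L (opens X),
    exists! x : X, forall mu : opens X, sval p mu = mu x.

Section Generated.
Context (d : Order.disp_t) (L : frameType d) (X : Type).
Implicit Types (zeta A : set (X -> L)).

Definition finite_infima zeta : set (X -> L) :=
  [set mu | exists2 s : seq (X -> L), (forall nu, nu \in s -> zeta nu) &
                                      mu = (\meet_(nu <- s) nu)%O].

Definition generated zeta : set (X -> L) :=
  [set mu | exists2 A, A `<=` finite_infima zeta & mu = bigsup A].

Lemma finite_infimaI zeta mu nu : finite_infima zeta mu ->
  finite_infima zeta nu -> finite_infima zeta (Order.meet mu nu).
Proof.
move=> [s zs ->] [t zt ->]; exists (s ++ t); last by rewrite big_cat.
by move=> k; rewrite mem_cat => /orP[/zs|/zt].
Qed.

Lemma sub_generated zeta : zeta `<=` generated zeta.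
Proof.
move=> mu zmu; exists [set mu].
  move=> _ ->; exists [:: mu]; last by rewrite big_seq1.
  by move=> nu; rewrite mem_seq1 => /eqP ->.
apply/eqP; rewrite eq_le bigsup_ub//=.
by apply: bigsup_least => _ ->.
Qed.

Lemma generated_ltopology zeta : is_ltopology (generated zeta).
Proof.
split.
- move=> B gB; exists [set m | finite_infima zeta m /\ (m <= bigsup B)%O].
    by move=> m [].
  apply/eqP; rewrite eq_le; apply/andP; split; apply: bigsup_least; last first.
    by move=> m [].
  move=> b Bb; have [A fA bE] := gB b Bb; rewrite bE.
  apply: bigsup_least => a Aa; apply: bigsup_ub; split; first exact: fA.
  by apply: (@le_trans _ _ b); [rewrite bE; exact: bigsup_ub|exact: bigsup_ub].
- exists [set \top%O].
    by move=> _ ->; exists [::]; rewrite ?big_nil.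
  by apply/eqP; rewrite eq_le lex1 andbT; apply: bigsup_ub.
- move=> _ _ [A fA ->] [B fB ->].
  exists [set m | exists a, exists b, [/\ A a, B b & m = Order.meet a b]].
    by move=> _ [a [b [Aa Bb ->]]]; apply: finite_infimaI; [exact: fA|exact: fB].
  apply/eqP; rewrite eq_le; apply/andP; split.
    rewrite meet_bigsup; apply: bigsup_least => _ [b Bb <-].
    rewrite meetC meet_bigsup; apply: bigsup_least => _ [a Aa <-].
    by apply: bigsup_ub; exists a, b; split; rewrite // meetC.
  apply: bigsup_least => _ [a [b [Aa Bb ->]]].
  by apply: leI2; apply: bigsup_ub.
Qed.

End Generated.

Definition sierpinski d (L : frameType d) : ltop L :=
  LTop (generated_ltopology [set (@id L)]).

Lemma sierpinski_T0 d (L : frameType d) : T0 (sierpinski L).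
Proof. by move=> x y xy; exists id => //; exact: sub_generated. Qed.

Record category := Category {
  obj :> Type;
  hom : obj -> obj -> Type;
  idm : forall x, hom x x;
  comp : forall x y z, hom y z -> hom x y -> hom x z;
  comp_idl : forall x y (f : hom x y), comp (idm y) f = f;
  comp_idr : forall x y (f : hom x y), comp f (idm x) = f;
  comp_assoc : forall x y z w (h : hom z w) (g : hom y z) (f : hom x y),
    comp h (comp g f) = comp (comp h g) f
}.
Arguments hom {C} x y : rename.
Arguments idm {C} x : rename.
Arguments comp {C x y z} g f : rename.

Definition full_subcategory (C : category) (P : C -> Prop) : category :=
  @Category {x : C | P x} (fun x y => hom (sval x) (sval y))
    (fun x => idm (sval x)) (fun x y z g f => comp g f)
    (fun x y f => comp_idl f) (fun x y f => comp_idr f)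
    (fun x y z w h g f => comp_assoc h g f).

Section CategoryNotions.
Context (C : category).

Definition epimorphism (x y : C) (f : hom x y) : Prop :=
  forall (z : C) (g h : hom y z), comp g f = comp h f -> g = h.

Definition isomorphic (x y : C) : Prop :=
  exists f : hom x y, exists g : hom y x,
    comp g f = idm x /\ comp f g = idm y.

(* A full subcategory is given by its class of objects. *)
Definition replete (P : C -> Prop) : Prop :=
  forall x y : C, isomorphic x y -> P x -> P y.

Definition epireflective (P : C -> Prop) : Prop :=
  replete P /\
  forall x : C, exists Rx : C, exists r : hom x Rx,
    [/\ epimorphism r, P Rx &
        forall (y : C) (f : hom x y), P y ->
          exists! f' : hom Rx y, f = comp f' r].

Definition is_epireflective_hull (E : C) (P : C -> Prop) : Prop :=
  [/\ epireflective P, P E &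
      forall Q : C -> Prop, epireflective Q -> Q E -> forall x, P x -> Q x].

End CategoryNotions.

Section LTopCategories.
Context (d : Order.disp_t) (L : frameType d).

Definition lmap (X Y : ltop L) : Type := {f : X -> Y | lcontinuous f}.

Definition lmap_id (X : ltop L) : lmap X X :=
  exist (@lcontinuous d L X X) id (fun nu onu => onu).

Definition lmap_comp (X Y Z : ltop L) (g : lmap Y Z) (f : lmap X Y) : lmap X Z :=
  exist (@lcontinuous d L X Z) (sval g \o sval f)
    (fun nu onu => svalP f _ (svalP g nu onu)).

Lemma lmapP (X Y : ltop L) (f g : lmap X Y) : sval f =1 sval g -> f = g.
Proof.
case: f g => [f cf] [g cg] /= /funext fg; rewrite -{g}fg in cg *.
by congr exist; exact: Prop_irrelevance.
Qed.

Definition LTopCat : category.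
Proof.
by apply: (@Category (ltop L) lmap lmap_id lmap_comp) => *; apply: lmapP.
Defined.

Definition LTop0 : category := full_subcategory (fun X : LTopCat => T0 X).

Definition sierpinski0 : LTop0 := exist _ (sierpinski L) (@sierpinski_T0 d L).

(* The evaluation at a point is a frame map; hence sober spaces are T0 and
   restricting sobriety to T0 spaces loses nothing. *)
Lemma eval_frame_map (X : ltop L) (x : X) :
  frame_map (fun mu : opens X => mu x).
Proof.
split=> // S; congr bigsup; apply/seteqP; split.
  by move=> _ [_ [mu Smu <-] <-]; exists mu.
by move=> _ [mu Smu <-]; exists (open_val mu) => //; exists mu.
Qed.

Lemma sober_T0 (X : ltop L) : sober X -> T0 X.
Proof.
move=> sX x y xy; apply: contrapT => nxy; apply: xy.
have [z [_ zu]] := sX (exist _ _ (eval_frame_map x)).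
rewrite -(zu x)// -(zu y)// => mu /=; apply: contrapT => mxy; apply: nxy.
exists mu => //; by have := open_valP mu; rewrite openE => /asboolP.
Qed.

Definition LSob (X : LTop0) : Prop := sober (sval X).

End LTopCategories.

(* Main.v *)
Require Import Defs.
From mathcomp Require Import all_boot all_order.
From mathcomp Require Import boolp classical_sets.

(** The sobrification of [X] is the space of points of its frame of opens; the
    unit is epi among T0 spaces because an open of the sobrification is
    determined by its restriction to [X].

    Minimality needs neither products nor extremal subobjects.  Opens of [X] are
    the morphisms from [X] to the Sierpinski space.  Hence, if [r : X -> RX] is
    the reflection into an epireflective class containing the Sierpinski space,
    every open [mu] of [X] is [nu \o r] for a unique open [nu] of [RX].  So each
    [y] in [RX] gives the point [mu |-> nu y] of the frame of opens of [X], and if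
    [X] is sober these points assemble into an inverse of [r]. *)

Set Implicit Arguments.
Unset Strict Implicit.
Unset Printing Implicit Defensive.

Import Order.TTheory.
Local Open Scope classical_set_scope.

(** Serves as induction on generated opens: a property closed under the frame operations need only
    be checked on generators. *)
Lemma generated_sub (d : Order.disp_t) (L : frameType d) (X : Type)
    (zeta tau : set (X -> L)) :
  is_ltopology tau -> zeta `<=` tau -> generated zeta `<=` tau.
Proof.
move=> [tS tT tM] zt _ [A Af ->]; apply: tS => mu /Af [s zs ->].
elim: s zs => [|nu s IHs] zs; first by rewrite big_nil.
rewrite big_cons; apply: tM; first by apply/zt/zs; rewrite mem_head.
by apply: IHs => k ks; apply: zs; rewrite inE ks orbT.
Qed.

Lemma bigsup_comp (d : Order.disp_t) (L : frameType d) (X Y : Type) (f : X -> Y)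
    (A : set (Y -> L)) :
  bigsup A \o f = bigsup [set nu \o f | nu in A].
Proof.
apply/funext => x; congr bigsup; apply/seteqP; split.
  by move=> _ [nu Anu <-]; exists (nu \o f) => //; exists nu.
by move=> _ [_ [nu Anu <-] <-]; exists nu.
Qed.

Lemma frame_map_comp d1 d2 d3 (A : frameType d1) (B : frameType d2)
    (C : frameType d3) (g : B -> C) (f : A -> B) :
  frame_map g -> frame_map f -> frame_map (g \o f).
Proof.
move=> [gT gM gS] [fT fM fS]; split=> [|a b|S] /=.
- by rewrite fT.
- by rewrite fM.
- by rewrite fS gS -image_comp.
Qed.

(** * Opens, their preimages, and the Sierpinski space *)

Section Opens.
Context (d : Order.disp_t) (L : frameType d).
Implicit Types X Y : ltop L.

Lemma ltop_open_val X (mu : opens X) : ltop_open X mu.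
Proof. by have := open_valP mu; rewrite openE => /asboolP. Qed.

Definition mk_open X (mu : X -> L) (omu : ltop_open X mu) : opens X :=
  @Opens _ _ X mu (asboolT omu).

Lemma opens_inj X (mu nu : opens X) : open_val mu = open_val nu -> mu = nu.
Proof. exact: val_inj. Qed.

Lemma opens_bigsupE X (A : set (opens X)) x :
  open_val (bigsup A) x = bigsup [set open_val mu x | mu in A].
Proof. exact: frame_map_bigsup (eval_frame_map x) A. Qed.

Definition preim X Y (f : X -> Y) (cf : lcontinuous f) (nu : opens Y) : opens X :=
  mk_open (cf _ (ltop_open_val nu)).

Lemma preim_frame_map X Y (f : X -> Y) (cf : lcontinuous f) :
  frame_map (preim cf).
Proof.
split; [exact: opens_inj|by move=> a b; exact: opens_inj|move=> A].
apply: opens_inj; apply/funext => x; rewrite [RHS]opens_bigsupE.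
rewrite -[LHS]/(open_val (bigsup A) (f x)) opens_bigsupE.
congr bigsup; apply/seteqP; split.
  by move=> _ [nu Anu <-]; exists (preim cf nu) => //; exists nu.
by move=> _ [_ [nu Anu <-] <-]; exists nu.
Qed.

Lemma T0_opens_eq X (x y : X) :
  T0 X -> (forall mu, ltop_open X mu -> mu x = mu y) -> x = y.
Proof.
by move=> T0X xy; apply: contrapT => /T0X [mu omu]; apply; exact: xy.
Qed.

Lemma sober_opens_eq X (x y : X) :
  sober X -> (forall mu : opens X, mu x = mu y) -> x = y.
Proof.
move=> /sober_T0 T0X xy; apply: T0_opens_eq => // mu omu.
exact: (xy (mk_open omu)).
Qed.

(** The functions [nu] with [nu \o mu] open form an L-topology, so only the generator [id], whose
    preimage is [mu], has to be tested. *)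
Lemma lcontinuous_sierpinski X (mu : X -> L) :
  lcontinuous (mu : X -> sierpinski L) <-> ltop_open X mu.
Proof.
split=> [/(_ id)|omu]; first by apply; exact: sub_generated.
suff tau_top : is_ltopology [set nu : L -> L | ltop_open X (nu \o mu)].
  by move=> nu; apply: (generated_sub tau_top) => _ ->.
have [tS tT tM] := ltop_axiom X; split => [A At||nu nu' o o'] //=.
- by rewrite bigsup_comp; apply: tS => _ [nu /At onu <-].
- exact: tM o o'.
Qed.

(** The value of a point [p] at the generator [id] lies in [L], the underlying set of the space, and
    is the element that represents [p]. *)
Lemma sierpinski_sober : sober (sierpinski L).
Proof.
case=> p /= [pT pM pS].
have oid : ltop_open (sierpinski L) id by exact: sub_generated.
exists (p (mk_open oid)); split=> [mu|x px]; last by rewrite px.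
set x := p (mk_open oid).
(* The opens at which [p] is evaluation at [x], taken as plain functions: an L-topology containing
   [id], hence all opens. *)
pose agree := [set nu : L -> L |
  exists2 mu : opens (sierpinski L), nu = open_val mu & p mu = mu x].
suff /(_ _ (ltop_open_val mu)) [nu munu pnu] :
  ltop_open (sierpinski L) `<=` agree
  by rewrite (@opens_inj (sierpinski L) mu nu munu).
apply: generated_sub => [|_ ->]; last by exists (mk_open oid).
split=> [A Aa||_ _ [mu1 -> e1] [mu2 -> e2]].
(* [B] lifts [A] to bundled opens; carrying the agreement along makes the two suprema range over the
   same values. *)
- pose B := [set mu | A (open_val mu) /\ p mu = mu x].
  exists (bigsup B).
    apply/funext => y; rewrite opens_bigsupE; congr bigsup; apply/seteqP; split.
      by move=> _ [nu Anu <-]; have [k nuk pk] := Aa _ Anu;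
        exists k; rewrite -?nuk//; split=> //; rewrite -nuk.
    by move=> _ [k [Ak _] <-]; exists (open_val k).
  rewrite pS opens_bigsupE; congr bigsup; apply/seteqP; split.
    by move=> _ [k [Ak pk] <-]; exists k.
  by move=> _ [k [Ak pk] <-]; exists k.
- by exists \top%O; rewrite ?pT.
- by exists (mu1 `&` mu2)%O; rewrite ?pM ?e1 ?e2.
Qed.

End Opens.

(** * The space of points of the frame of opens *)

Section Sobrification.
Context (d : Order.disp_t) (L : frameType d) (X : ltop L).

Definition pt_eval (mu : opens X) : pt L (opens X) -> L := fun p => sval p mu.

Lemma bigsup_pt_eval (A : set (opens X)) :
  pt_eval (bigsup A) = bigsup [set pt_eval mu | mu in A].
Proof.
apply/funext => -[p fp]; rewrite /pt_eval /= frame_map_bigsup//.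
congr bigsup; apply/seteqP; split.
  by move=> _ [mu Amu <-]; exists (pt_eval mu) => //; exists mu.
by move=> _ [_ [mu Amu <-] <-]; exists mu.
Qed.

Lemma pt_eval_ltopology : is_ltopology (range pt_eval).
Proof.
split=> [A At||_ _ [mu _ <-] [nu _ <-]].
- exists (bigsup [set mu | A (pt_eval mu)]) => //.
  rewrite bigsup_pt_eval; congr bigsup; apply/seteqP; split.
    by move=> _ [mu Amu <-].
  by move=> nu Anu; have [mu _ munu] := At _ Anu; exists mu; rewrite /= ?munu.
- by exists \top%O => //; apply/funext => -[p [pT pM pS]].
- by exists (mu `&` nu)%O => //; apply/funext => -[p [pT pM pS]]; exact: pM.
Qed.

Definition sobrification : ltop L := LTop pt_eval_ltopology.

Definition sobrification_unit (x : X) : sobrification :=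
  exist _ _ (eval_frame_map x).

Lemma sobrification_unit_continuous : lcontinuous sobrification_unit.
Proof. by move=> _ [mu _ <-]; exact: ltop_open_val. Qed.

Lemma pt_ext (p q : sobrification) : sval p =1 sval q -> p = q.
Proof.
case: p q => [p fp] [q fq] /= /funext pq; rewrite -{q}pq in fq *.
by congr exist; exact: Prop_irrelevance.
Qed.

(** Restricting [pt_eval mu] along the unit gives back [mu]. *)
Lemma sobrification_open_ext (nu nu' : sobrification -> L) :
  ltop_open sobrification nu -> ltop_open sobrification nu' ->
  nu \o sobrification_unit = nu' \o sobrification_unit -> nu = nu'.
Proof. by move=> [mu _ <-] [mu' _ <-] /(@opens_inj _ _ X mu mu') ->. Qed.

Definition open_pt_eval (mu : opens X) : opens sobrification :=
  @mk_open _ _ sobrification (pt_eval mu) (imageP pt_eval I).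

Lemma open_pt_eval_frame_map : frame_map open_pt_eval.
Proof.
split=> [|mu nu|A]; apply: opens_inj; apply/funext => -[p [pT pM pS]].
- exact: pT.
- exact: pM.
- by rewrite [RHS]opens_bigsupE image_comp; exact: pS.
Qed.

(** A point [q] composed with [open_pt_eval] is a point of the opens of [X], hence an element of the
    space; every open is some [pt_eval mu], so this element represents [q]. *)
Lemma sobrification_sober : sober sobrification.
Proof.
case=> q fq /=.
exists (exist _ _ (frame_map_comp fq open_pt_eval_frame_map)); split=> [nu|p pq].
  have [mu _ munu] := ltop_open_val nu.
  by rewrite -munu /=; congr q; exact: opens_inj.
by apply: pt_ext => mu /=; rewrite (pq (open_pt_eval mu)).
Qed.

(** A point [p] precomposed with preimage under [f] is a point of the opens of [Y]; sobriety
    represents it by an element, taken as [g p]. *)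
Lemma sobrification_extend (Y : ltop L) (f : X -> Y) :
  sober Y -> lcontinuous f ->
  exists2 g : sobrification -> Y, lcontinuous g & g \o sobrification_unit = f.
Proof.
move=> sY cf.
have /choice[g gP] (p : sobrification) :
    exists y : Y, forall nu : opens Y, sval p (preim cf nu) = nu y.
  by have [y [yP _]] := sY (exist _ _
    (frame_map_comp (svalP p) (preim_frame_map cf))); exists y.
exists g.
  move=> nu onu; exists (preim cf (mk_open onu)) => //.
  (* The preimage of [nu] under [g] is [pt_eval] of its preimage under [f]. *)
  by apply/funext => p; exact: gP.
by apply/funext => x; apply: sober_opens_eq => // nu; rewrite -gP.
Qed.

End Sobrification.

(** * Epireflectivity and minimality *)

Section Hull.
Context (d : Order.disp_t) (L : frameType d).

Lemma LSob_replete : replete (@LSob d L).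
Proof.
move=> [X T0X] [Y T0Y] [[f cf] [[g cg] /= [gf fg]]] sX p.
have fgK y : f (g y) = y by exact: (congr1 (fun h => sval h y) fg).
have [x [xP _]] := sX (exist _ _
  (frame_map_comp (svalP p) (preim_frame_map cg))).
(* Pulling [nu] back along [f] and then [g] returns [nu], so [f x] represents [p]. *)
have pE (nu : opens Y) : sval p nu = nu (f x).
  rewrite -[RHS](xP (preim cf nu)) /=; congr (sval p _).
  by apply: opens_inj; apply/funext => y /=; rewrite fgK.
exists (f x); split=> // y yP; apply: T0_opens_eq => // nu onu.
exact: etrans (esym (pE (mk_open onu))) (yP (mk_open onu)).
Qed.

Lemma LSob_epireflective : epireflective (@LSob d L).
Proof.
split; first exact: LSob_replete.
move=> [X T0X].
pose SX : LTop0 L := exist _ _ (sober_T0 (@sobrification_sober _ _ X)).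
pose r : @hom (LTop0 L) (exist _ X T0X) SX :=
  exist _ _ (@sobrification_unit_continuous _ _ X).
exists SX, r.
(* Preimages of an open under [g] and [h] agree on [X], hence everywhere; [Z] being T0, [g] and [h]
   coincide. *)
have r_epi : epimorphism r.
  move=> [Z T0Z] [g cg] [h ch] /= gh; apply: lmapP => p /=.
  apply: T0_opens_eq => // nu onu.
  have {}gh : g \o @sobrification_unit _ _ X = h \o @sobrification_unit _ _ X.
    exact: (congr1 sval gh).
  have /(congr1 (fun k => k p)) // : nu \o g = nu \o h.
  apply: sobrification_open_ext; [exact: cg|exact: ch|].
  by rewrite -compA gh.
split=> //; first exact: sobrification_sober.
move=> [Y T0Y] [f cf] sY.
have [g cg gf] := sobrification_extend sY cf.
exists (exist _ g cg); split.
  by apply: lmapP => x /=; rewrite -gf.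
move=> h fh; apply: r_epi; rewrite -fh.
by apply: lmapP => x /=; rewrite -gf.
Qed.

Lemma LSob_minimal (Q : LTop0 L -> Prop) :
  epireflective Q -> Q (sierpinski0 L) -> forall X, LSob X -> Q X.
Proof.
move=> [Qrep Qrefl] QS X sX; have [RX [r [r_epi QRX rP]]] := Qrefl X.
apply: Qrep QRX.
case: X RX r sX r_epi rP {Qrefl} => [X T0X] [RX T0R] [r cr] sX r_epi rP.
(* Cancel the epimorphism [r] on maps into the Sierpinski space. *)
have r_inj (nu nu' : opens RX) : preim cr nu = preim cr nu' -> nu = nu'.
  move=> nunu'; apply: opens_inj.
  pose m (k : opens RX) : lmap RX (sierpinski L) :=
    exist _ _ ((lcontinuous_sierpinski k).2 (ltop_open_val k)).
  suff /(congr1 sval) : m nu = m nu' by [].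
  apply: (r_epi (sierpinski0 L)); apply: lmapP => x /=.
  exact: (congr1 (fun k : opens X => k x) nunu').
have /choice[e eK] (mu : opens X) : exists nu : opens RX, preim cr nu = mu.
  have cmu := (lcontinuous_sierpinski mu).2 (ltop_open_val mu).
  have [[nu cnu] [/= nuE _]] := rP (sierpinski0 L) (exist _ _ cmu) QS.
  exists (mk_open ((lcontinuous_sierpinski nu).1 cnu)); apply: opens_inj.
  exact/esym/(congr1 sval nuE).
have [rT rM rS] := preim_frame_map cr.
(* [e] is a section of the injective frame map [preim cr], so each law may be checked after applying
   the latter. *)
have e_frame_map : frame_map e.
  split=> [|mu nu|A]; apply: r_inj; rewrite eK.
  - by rewrite rT.
  - by rewrite rM !eK.
  - rewrite rS image_comp; congr bigsup; apply/seteqP; split.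
      by move=> mu Amu; exists mu; rewrite //= eK.
    by move=> _ [mu Amu <-]; rewrite /= eK.
have /choice[s sP] (y : RX) : exists x : X, forall mu : opens X, e mu y = mu x.
  have [x [xP _]] := sX (exist _ _ (frame_map_comp (eval_frame_map y) e_frame_map)).
  by exists x.
have cs : @lcontinuous _ _ RX X s.
  move=> mu omu; suff -> : mu \o s = e (mk_open omu) by exact: ltop_open_val.
  by apply/funext => y; rewrite sP.
exists (exist _ s cs), (exist _ r cr); split.
  (* For [r \o s]: an open [nu] at [r (s y)] is its preimage at [s y], that is, [e] of that preimage
     at [y], and [e] returns [nu]. *)
  apply: lmapP => y; apply: T0_opens_eq => // nu onu.
  rewrite -[LHS](sP y (preim cr (mk_open onu))).
  by rewrite (r_inj (e _) (mk_open onu)) ?eK.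
apply: lmapP => x; apply: sober_opens_eq => // mu; rewrite -sP.
exact: (congr1 (fun k : opens X => k x) (eK mu)).
Qed.

End Hull.

Theorem theorem7p3 (d : Order.disp_t) (L : frameType d) :
  is_epireflective_hull (sierpinski0 L) (@LSob d L).
Proof.
split; first exact: LSob_epireflective.
- exact: sierpinski_sober.
- exact: LSob_minimal.
Qed.
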